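(* Let $A=[A_{xy}]_{1\le x,y\le n}$ be a $(0,1)$ irreducible matrix of size $n$ with Perron root $\theta$. Let $\mathcal{F}=\{xy \mid A_{xy}=0,\ 1\le x,y\le n\}$ (a collection of words of length two over the symbols $\{1,\dots,n\}$), labelled as $\{a_1,\dots,a_s\}$. Let $u=(u_x)_{1\le x\le n}$ and $v=(v_x)_{1\le x\le n}$ be the vectors defined by \[ u_x=1-\sum_{\substack{1\le i\le s\\ a_i\text{ ends with }x}} \mathcal{R}_i(\theta),\qquad v_x=1-\sum_{\substack{1\le i\le s\\ a_i\text{ begins with }x}} \mathcal{C}_i(\theta). \] Then $u_xv_x>0$ for each $x$. Moreover, $v$ and $u$ are right and left Perron eigenvectors, respectively, of $A$. Further, if $\theta>1$, then \[ u^Tv=\theta\left(1+r'(\theta)\right). \]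
   Context: A non-negative square matrix $A$ is irreducible if for all $i,j$ there is $\ell\ge 1$ with $(A^\ell)_{ij}>0$. Its Perron root $\theta$ is its spectral radius (an eigenvalue of $A$); a right (left) Perron eigenvector of an irreducible $A$ is a right (left) eigenvector for $\theta$ with all entries positive; left eigenvectors are written as columns $u$ with $u^TA=\theta u^T$. Correlation: for words $x=x_1\dots x_{p_1}$ and $y=y_1\dots y_{p_2}$, the correlation polynomial is $(x,y)_z=\sum_{\ell=0}^{p_1-1}b_\ell z^{p_1-1-\ell}$, where $b_\ell=1$ if $x_{\ell+k}=y_k$ for all $1\le k\le \min(p_1-\ell,p_2)$, and $b_\ell=0$ otherwise. The correlation matrix of $\mathcal{F}$ is $\mathcal{M}(z)=[(a_j,a_i)_z]_{1\le i,j\le s}$ (the $(i,j)$ entry is $(a_j,a_i)_z$); its determinant is a non-zero polynomial. The rational function $r(z)$ is the sum of all entries of $\mathcal{M}(z)^{-1}$; $\mathcal{R}_i(z)$ is the sum of the entries of the $i$th row and $\mathcal{C}_j(z)$ the sum of the entries of the $j$th column of $\mathcal{M}(z)^{-1}$. Values at $\theta$ are understood as limits: $\mathcal{R}_i(\theta)=\lim_{z\to\theta}\mathcal{R}_i(z)$, $\mathcal{C}_j(\theta)=\lim_{z\to\theta}\mathcal{C}_j(z)$, and $r'(\theta)$ is the derivative at $\theta$ of $r$ with any removable singularity removed. If $\mathcal{F}$ is empty, the sums are empty and $r=0$. *)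

(* Defs.v *)
From HB Require Import structures.
From mathcomp Require Import all_boot all_order all_algebra.
From mathcomp Require Import complex.
From mathcomp Require Import all_classical all_reals all_analysis.

Set Implicit Arguments.
Unset Strict Implicit.
Unset Printing Implicit Defensive.

Import Order.TTheory GRing.Theory Num.Theory.
Import numFieldNormedType.Exports.

Local Open Scope classical_set_scope.
Local Open Scope ring_scope.

Section Perron.
Context {R : realType} {n : nat}.
Implicit Types (A : 'M[R]_n) (u v : 'cV[R]_n).

Definition zero_one_mx A : Prop := forall x y, A x y = 0 \/ A x y = 1.

Definition irreducible_mx A : Prop :=
  (forall x y, 0 <= A x y) /\
  (forall x y, exists2 l : nat, (1 <= l)%N & 0 < (A ^+ l) x y).

(* The eigenvalues range over R[i]; the norm of R[i] is R[i]-valued with zero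
   imaginary part, whence the projection. *)
Definition spectral_radius A : R :=
  sup [set complex.Re `|l| | l in
        [set l : R[i] | eigenvalue (map_mx (real_complex R) A) l]].

Definition right_perron_eigenvector A v : Prop :=
  [/\ v != 0, A *m v = spectral_radius A *: v & forall x, 0 < v x 0].

Definition left_perron_eigenvector A u : Prop :=
  [/\ u != 0, u^T *m A = spectral_radius A *: u^T & forall x, 0 < u x 0].

Definition forbidden_words A : seq (seq 'I_n) :=
  [seq [:: p.1; p.2] | p <- enum {: 'I_n * 'I_n} & A p.1 p.2 == 0].

End Perron.

Section Correlation.
Context {R : realType} {T : eqType}.

(* Positions are counted from 0; both lookups are within bounds. *)
Definition corr_bit (x y : seq T) (l : nat) : bool :=
  [forall k : 'I_(minn (size x - l) (size y)), onth x (l + k) == onth y k].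

Definition corr_poly (x y : seq T) : {poly R} :=
  \sum_(l < size x) (corr_bit x y l)%:R *: 'X^(size x - 1 - l).

Context {s : nat}.
Implicit Types (a : s.-tuple (seq T)) (z : R).

Definition corr_mx a : 'M[{poly R}]_s :=
  \matrix_(i, j) corr_poly (tnth a j) (tnth a i).

(* [invmx] returns its argument on singular matrices, so the four functions of
   z below are meaningful only away from the finitely many roots of
   [\det (corr_mx a)]. *)
Definition inv_corr_mx a z : 'M[R]_s :=
  invmx (map_mx (fun p : {poly R} => p.[z]) (corr_mx a)).

Definition corr_row_sum a (i : 'I_s) z : R := \sum_j inv_corr_mx a z i j.

Definition corr_col_sum a (j : 'I_s) z : R := \sum_i inv_corr_mx a z i j.

Definition corr_sum a z : R := \sum_i \sum_j inv_corr_mx a z i j.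

End Correlation.

(* The value at z of a function whose removable singularities are removed; it
   is a limit over a punctured neighbourhood. *)
Definition reg_val {R : realType} (f : R -> R) (z : R) : R :=
  lim (f w @[w --> z^']).

(* Main.v *)
Require Import Defs.
From mathcomp Require Import all_boot all_order all_algebra.
From mathcomp Require Import complex ring.
From mathcomp Require Import all_classical all_reals all_analysis.

(** Write J for the all-ones matrix, K = J - A for the matrix of forbidden
    pairs, and 1 for an all-ones column.  Let B (resp. E) be the 0/1 matrix
    sending a forbidden word to its first (resp. last) letter.  Two words of
    length two overlap either completely or in one letter, so the correlation
    matrix is M(z) = z I + B E^T, while counting the words with prescribed
    first and last letters gives B^T E = K and E^T B = K^T.

    Hence M(z) is a low-rank companion of the n x n matrices z I + K and
    z I + K^T: by [push_through], M(z)^-1 B = B (z I + K^T)^-1.  Every word has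
    one first and one last letter, so B 1 = 1 = E 1, and the row sums of
    M(z)^-1 are the vector B y(z) with y(z) = (z I + K^T)^-1 1; likewise the
    column sums are E w(z) with w(z) = (z I + K)^-1 1, and
    r(z) = n - z 1^T y(z).

    All of this is regular at theta, because theta I + K = (theta I - A) + J is
    invertible: a row w in its kernel is orthogonal to 1 (pair the equation
    with the right Perron eigenvector), hence is a left eigenvector of A for
    theta, hence a multiple of the positive one, hence zero
    ([perron_shift_unitmx]).  The same pairing shows that w(theta) and y(theta)
    have entries summing to 1 and are positive right and left eigenvectors of A
    ([perron_vecP]).  Reading off the definitions,
    u = 1 - E^T B y(theta) = theta y(theta) and v = theta w(theta).

    For the derivative, multiplying (z I + K^T) y(z) = 1 on the left by
    w(theta)^T gives 1^T y(z) + (z - theta) w(theta)^T y(z) = 1, so that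
    r(z) = n - z + z (z - theta) w(theta)^T y(z) near theta.  Therefore
    r'(theta) = theta w(theta)^T y(theta) - 1, and
    theta (1 + r'(theta)) = theta^2 w(theta)^T y(theta) = u^T v.

    A positive eigenvector of an irreducible matrix is found as an optimum of
    the Collatz-Wielandt problem, the largest t with t x <= x A for some x in
    the simplex ([perron_exists]); geometric simplicity is [perron_simple], and
    its eigenvalue is the spectral radius by [spectral_radius_eq]. *)

Set Implicit Arguments.
Unset Strict Implicit.
Unset Printing Implicit Defensive.

Import Order.TTheory GRing.Theory Num.Theory.
Import numFieldNormedType.Exports.

Local Open Scope classical_set_scope.
Local Open Scope ring_scope.

Local Notation ones := (const_mx 1).

(** * Perron-Frobenius theory *)

Lemma sum_ord_gt0 (R : numDomainType) n (f : 'I_n -> R) :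
  (0 < n)%N -> (forall i, 0 < f i) -> 0 < \sum_i f i.
Proof.
move=> n_gt0 f_gt0; rewrite (bigD1 (Ordinal n_gt0)) //= ltr_pwDl //.
by rewrite sumr_ge0 // => i _; exact: ltW.
Qed.

Section Perron.
Context {R : realType} {n : nat}.
Implicit Types (A P : 'M[R]_n) (x : 'rV[R]_n) (rho : R).

(** For an irreducible matrix and L large, this is an entrywise positive matrix
    that commutes with it; it turns weak inequalities into strict ones. *)
Definition power_sum A L : 'M[R]_n := \sum_(l < L) A ^+ l.+1.

Lemma irreducible_trmx A : irreducible_mx A -> irreducible_mx A^T.
Proof.
case=> A_ge0 A_irr; split=> [i j|i j]; first by rewrite mxE.
have [l l_gt0 Al] := A_irr j i; exists l => //.
suff -> : A^T ^+ l = (A ^+ l)^T by rewrite mxE.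
elim: {l_gt0 Al} l => [|l IH]; first by rewrite !expr0 trmx1.
by rewrite exprS exprSr IH -!mulmxE trmx_mul.
Qed.

Lemma power_sum_gt0 A : irreducible_mx A ->
  exists L, forall i j, 0 < power_sum A L i j.
Proof.
case=> A_ge0 A_irr.
have Al_ge0 l i j : 0 <= (A ^+ l) i j.
  elim: l i j => [|l IH] i j; first by rewrite expr0 mxE ler0n.
  by rewrite exprS -mulmxE mxE sumr_ge0 // => k _; rewrite mulr_ge0.
have /choice[f fP] : forall ij : 'I_n * 'I_n,
    exists l, 0 < (A ^+ l.+1) ij.1 ij.2.
  by move=> [i j]; have [[|l] // _ Al] := A_irr i j; exists l.
exists (\max_ij f ij).+1 => i j; rewrite /power_sum summxE.
have fL : (f (i, j) < (\max_ij f ij).+1)%N by rewrite ltnS leq_bigmax.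
rewrite (bigD1 (Ordinal fL)) //= ltr_pwDl ?(fP (i, j)) // sumr_ge0 // => l _.
Qed.

Lemma mul_power_sumC A L : A *m power_sum A L = power_sum A L *m A.
Proof.
rewrite /power_sum mulmx_sumr mulmx_suml; apply: eq_bigr => l _.
by rewrite !mulmxE -exprS -exprSr.
Qed.

Lemma eigen_power_sum A L x rho : x *m A = rho *: x ->
  x *m power_sum A L = (\sum_(l < L) rho ^+ l.+1) *: x.
Proof.
move=> xA; rewrite mulmx_sumr scaler_suml; apply: eq_bigr => l _.
elim: (nat_of_ord l) => {l} [|l IH]; first by rewrite !expr1.
by rewrite exprS -mulmxE mulmxA xA -scalemxAl IH scalerA -exprS.
Qed.

Lemma mul_gt0_mx P x : (forall i j, 0 < P i j) ->
  (forall i, 0 <= x 0 i) -> x != 0 -> forall j, 0 < (x *m P) 0 j.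
Proof.
move=> P_gt0 x_ge0 /eqP x_neq0 j; rewrite mxE.
have xP_ge0 i : true -> 0 <= x 0 i * P i j by rewrite mulr_ge0 // ltW.
rewrite lt0r sumr_ge0 // andbT psumr_eq0 //; apply/negP => /allP xP0.
apply/x_neq0/rowP => i; rewrite !mxE; have /= := xP0 i (mem_index_enum i).
by rewrite mulf_eq0 (gt_eqF (P_gt0 _ _)) orbF => /eqP.
Qed.

(** If P is the positive power sum, x P is positive and is also a multiple of
    the eigenvector x. *)
Lemma ge0_eigenvector_gt0 A x rho : irreducible_mx A ->
  x *m A = rho *: x -> (forall i, 0 <= x 0 i) -> x != 0 ->
  0 < rho /\ forall i, 0 < x 0 i.
Proof.
move=> A_irr xA x_ge0 x_neq0; have [L P_gt0] := power_sum_gt0 A_irr.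
have := mul_gt0_mx P_gt0 x_ge0 x_neq0; rewrite (eigen_power_sum L xA).
set kappa := \sum_(_ < _) _ => kx_gt0.
have x_gt0 i : 0 < x 0 i.
  rewrite lt0r x_ge0 andbT; have := kx_gt0 i; rewrite mxE.
  by apply: contraTneq => ->; rewrite mulr0 ltxx.
split=> //; have [i _] : exists i, x 0 i != 0 by apply/rV0Pn.
have rho_ge0 : 0 <= rho.
  have := congr1 (fun y : 'rV__ => y 0 i) xA; rewrite !mxE => /esym rx.
  rewrite -(pmulr_lge0 _ (x_gt0 i)) rx sumr_ge0 // => j _.
  by rewrite mulr_ge0 //; case: A_irr.
rewrite lt0r rho_ge0 andbT; apply/eqP => rho0; have := kx_gt0 i.
rewrite /kappa big1 => [|l _]; last by rewrite rho0 expr0n.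
by rewrite scale0r mxE ltxx.
Qed.

(** Take the largest ratio m = w_i / x_i: then m x - w is a nonnegative
    eigenvector with a zero entry, so it cannot be nonzero. *)
Lemma perron_simple A x w rho : irreducible_mx A ->
  x *m A = rho *: x -> (forall i, 0 < x 0 i) -> w *m A = rho *: w ->
  exists m, w = m *: x.
Proof.
move=> A_irr xA x_gt0 wA.
have [->|/rV0Pn[i0 _]] := eqVneq w 0; first by exists 0; rewrite scale0r.
case: (arg_maxP (fun i => w 0 i / x 0 i) (erefl : xpredT i0)) => i _ i_max.
pose m := w 0 i / x 0 i; exists m; apply/eqP; rewrite eq_sym -subr_eq0.
apply/negPn/negP => y_neq0.
have y_ge0 j : 0 <= (m *: x - w) 0 j.
  by rewrite !mxE subr_ge0 -ler_pdivrMr //; exact: i_max.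
have yA : (m *: x - w) *m A = rho *: (m *: x - w).
  by rewrite mulmxBl -scalemxAl xA wA scalerBr scalerA mulrC -scalerA.
have [_ /(_ i)] := ge0_eigenvector_gt0 A_irr yA y_ge0 y_neq0.
by rewrite !mxE divfK ?subrr ?ltxx // gt_eqF.
Qed.

Lemma subinvariant_ub A x t : (forall i j, 0 <= A i j) ->
  (forall i, 0 <= x 0 i) -> \sum_i x 0 i = 1 ->
  (forall j, t * x 0 j <= (x *m A) 0 j) -> t <= \sum_i \sum_j A i j.
Proof.
move=> A_ge0 x_ge0 x_sum tx.
have x_le1 i : x 0 i <= 1 by rewrite -x_sum (bigD1 i) //= lerDl sumr_ge0.
rewrite -[t]mulr1 -{1}x_sum mulr_sumr.
rewrite (le_trans (ler_sum _ (fun j _ => tx j))) //.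
rewrite exchange_big; apply: ler_sum => j _; rewrite mxE.
by apply: ler_sum => i _; rewrite ler_piMl.
Qed.

(** The pairs (t, x) with x in the standard simplex and t x <= x A.  The scalar
    is kept as a coordinate because the Collatz-Wielandt function
    x |-> min_j (x A)_j / x_j is not continuous on the boundary of the simplex,
    whereas this set is compact and t is continuous on it. *)
Definition subinvariant A : set (R * 'rV[R]_n) :=
  [set p : R * 'rV[R]_n |
    [/\ 0 <= p.1, forall i, 0 <= p.2 0 i, \sum_i p.2 0 i = 1 &
        forall j, p.1 * p.2 0 j <= (p.2 *m A) 0 j]].

Lemma subinvariant_compact A : (forall i j, 0 <= A i j) ->
  compact (subinvariant A).
Proof.
move=> A_ge0; pose T : set (R * 'rV[R]_n) := `[0, \sum_i \sum_j A i j] `*`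
  [set v : 'rV[R]_n | forall i, `[0, 1]%classic (v ord0 i)].
have T_compact : compact T.
  apply: compact_setX; first exact: segment_compact.
  apply: (@rV_compact R n (fun=> `[0, 1]%classic)) => i.
  exact: segment_compact.
apply: (subclosed_compact _ T_compact).
  have fst_cont : continuous (fst : R * 'rV[R]_n -> R).
    by move=> p; exact: cvg_fst.
  have coord_cont i : continuous (fun p : R * 'rV[R]_n => p.2 0 i).
    move=> p; apply: (@continuous_comp _ _ _ snd (fun v : 'rV[R]_n => v 0 i)).
      exact: cvg_snd.
    exact: coord_continuous.
  have sum_cont (F : 'I_n -> R * 'rV[R]_n -> R) :
      (forall i, continuous (F i)) -> continuous (fun p => \sum_i F i p).
    by move=> F_cont; apply: continuous_big => //; exact: add_continuous.
  have ge0_closed (f : R * 'rV[R]_n -> R) :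
      continuous f -> closed [set p : R * 'rV[R]_n | 0 <= f p].
    move=> f_cont; rewrite (_ : [set p | _] = f @^-1` [set r | 0 <= r]) //.
    by apply: closed_comp => [p _|]; [exact: f_cont | exact: closed_ge].
  rewrite (_ : subinvariant A =
    [set p : R * 'rV[R]_n | 0 <= p.1] `&`
    (\bigcap_i [set p : R * 'rV[R]_n | 0 <= p.2 0 i]) `&`
    [set p : R * 'rV[R]_n | \sum_i p.2 0 i = 1] `&`
    (\bigcap_j [set p : R * 'rV[R]_n |
       0 <= (\sum_i p.2 0 i * A i j) - p.1 * p.2 0 j])).
    apply: closedI; first apply: closedI; first apply: closedI.
    - exact: ge0_closed.
    - by apply: closed_bigI => i _; exact: ge0_closed.
    - rewrite (_ : [set p | _] =
        (fun p : R * 'rV[R]_n => \sum_i p.2 0 i) @^-1` [set 1]) //.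
      by apply: closed_comp => [p _|]; [exact: sum_cont | exact: closed_eq].
    - apply: closed_bigI => j _; apply: ge0_closed => p; apply: cvgB.
        apply: sum_cont => i q.
        by apply: cvgM; [exact: coord_cont | exact: cvg_cst].
      by apply: cvgM; [exact: fst_cont | exact: coord_cont].
  apply/seteqP; split=> p.
    case=> p1 p2 p3 pA; split; first by split=> //; split=> // i _; exact: p2.
    by move=> j _ /=; rewrite subr_ge0; have := pA j; rewrite mxE.
  case=> -[[p1 p2] p3] pA; split=> // [i|j]; first exact: p2.
  by rewrite -subr_ge0 mxE; exact: pA.
move=> [t x] [/= t_ge0 x_ge0 x_sum tx]; split=> /=.
  by rewrite in_itv /= t_ge0 (subinvariant_ub _ x_ge0 x_sum tx).
move=> i; rewrite /= in_itv /= x_ge0 -x_sum (bigD1 i) //= lerDl.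
by rewrite sumr_ge0.
Qed.

(** Let (rho, x) maximise the scalar over the compact set [subinvariant A].  If
    x A - rho x were nonzero, multiplying by the positive power sum P would
    make x P satisfy a strict inequality in every entry, leaving room to
    increase rho. *)
Lemma perron_exists A : (0 < n)%N -> irreducible_mx A ->
  exists rho x, (forall i, 0 < x 0 i) /\ x *m A = rho *: x.
Proof.
move=> n_gt0 A_irr; have [A_ge0 _] := A_irr.
have n_neq0 : n%:R != 0 :> R by rewrite pnatr_eq0 -lt0n.
have W0 : subinvariant A !=set0.
  exists (0, const_mx n%:R^-1); split=> //= [i||j].
  - by rewrite mxE invr_ge0.
  - under eq_bigr do rewrite mxE.
    by rewrite sumr_const card_ord -[LHS]mulr_natl divff.
  - rewrite mul0r mxE sumr_ge0 // => i _.
    by rewrite mxE mulr_ge0 // invr_ge0.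
have [|[rho x]] := compact_EVT_max (f := fst) W0 (subinvariant_compact A_ge0).
  by apply: continuous_subspaceT => p; exact: cvg_fst.
rewrite inE => -[/= rho_ge0 x_ge0 x_sum rhox] rho_max.
have x_neq0 : x != 0.
  apply/eqP => x0; move: x_sum; rewrite x0 big1 => [/esym/eqP|i _].
    by rewrite oner_eq0.
  by rewrite mxE.
suff xA : x *m A = rho *: x.
  by exists rho, x; split=> //; case: (ge0_eigenvector_gt0 A_irr xA).
apply/eqP; rewrite -subr_eq0; apply/negPn/negP => d_neq0.
have d_ge0 j : 0 <= (x *m A - rho *: x) 0 j.
  by have := rhox j; rewrite !mxE subr_ge0.
have [L P_gt0] := power_sum_gt0 A_irr; set P := power_sum A L in P_gt0.
have y_gt0 := mul_gt0_mx P_gt0 x_ge0 x_neq0.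
have := mul_gt0_mx P_gt0 d_ge0 d_neq0.
rewrite mulmxBl -scalemxAl -mulmxA mul_power_sumC mulmxA -/P.
set y := x *m P in y_gt0 *; move=> yA_gt0.
pose S := \sum_i y 0 i.
pose i0 := Ordinal n_gt0.
have S_gt0 : 0 < S by exact: sum_ord_gt0.
pose f j := (y *m A - rho *: y) 0 j.
case: (arg_minP (fun j => f j / y 0 j) (erefl : xpredT i0)) => k _ k_min.
(* The largest increment of rho that y still tolerates in every entry. *)
pose eps := f k / y 0 k.
have eps_gt0 : 0 < eps by rewrite divr_gt0 // yA_gt0.
suff : rho + eps <= rho by rewrite gerDl leNgt eps_gt0.
apply: (rho_max (rho + eps, S^-1 *: y)); rewrite inE; split=> /= [|i||j].
- by rewrite addr_ge0 // ltW.
- by rewrite mxE mulr_ge0 ?invr_ge0 ?ltW.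
- under eq_bigr do rewrite mxE.
  by rewrite -mulr_sumr mulVf // gt_eqF.
- rewrite -scalemxAl !mxE mulrCA ler_pM2l ?invr_gt0 //.
  have := k_min j erefl; rewrite -/eps ler_pdivlMr // /f !mxE mulrDl.
  by rewrite lerBrDl.
Qed.

(** Pairing |z A| <= |z| A with the positive right eigenvector y bounds every
    complex eigenvalue by rho, for both sides are then multiples of the positive
    number |z| y; and rho is itself an eigenvalue, by x. *)
Lemma spectral_radius_eq A x (y : 'cV[R]_n) rho : (0 < n)%N ->
  (forall i j, 0 <= A i j) ->
  (forall i, 0 < x 0 i) -> x *m A = rho *: x ->
  (forall i, 0 < y i 0) -> A *m y = rho *: y ->
  spectral_radius A = rho.
Proof.
move=> n_gt0 A_ge0 x_gt0 xA y_gt0 Ay.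
pose i0 := Ordinal n_gt0.
have rho_ge0 : 0 <= rho.
  have := congr1 (fun z : 'rV__ => z 0 i0) xA; rewrite !mxE => /esym rx.
  rewrite -(pmulr_lge0 _ (x_gt0 i0)) rx sumr_ge0 // => j _.
  by rewrite mulr_ge0 // ltW.
pose toC := real_complex R.
rewrite /spectral_radius; set E := (X in sup X).
have E_rho : E rho.
  exists rho%:C%C; last by rewrite normc_def /= expr0n addr0 sqrtr_sqr ger0_norm.
  apply/eigenvalueP; exists (map_mx toC x).
    by rewrite -map_mxM xA map_mxZ.
  apply/eqP => /rowP /(_ i0); rewrite !mxE => /(congr1 (@complex.Re _)) /= x0.
  by have := x_gt0 i0; rewrite x0 ltxx.
have E_ub : ubound E rho.
  move=> _ [l /eigenvalueP[z zA z_neq0] <-].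
  suff : `|l| <= rho%:C%C by rewrite lecE => /andP[].
  pose N := \sum_j `|z 0 j| * (y j 0)%:C%C.
  have N_ge0 j : true -> 0 <= `|z 0 j| * (y j 0)%:C%C.
    by rewrite mulr_ge0 // lecR ltW.
  have N_gt0 : 0 < N.
    rewrite lt0r sumr_ge0 // andbT psumr_eq0 //; apply/negP => /allP N0.
    move/eqP: z_neq0; apply; apply/rowP => j; rewrite mxE.
    have /= := N0 j (mem_index_enum j).
    rewrite mulf_eq0 normr_eq0 => /orP[/eqP //|/eqP/(congr1 (@complex.Re _)) /= y0].
    by have := y_gt0 j; rewrite y0 ltxx.
  rewrite -(ler_pM2r N_gt0) /N !mulr_sumr.
  apply: (@le_trans _ _
    (\sum_j (\sum_i `|z 0 i| * (A i j)%:C%C) * (y j 0)%:C%C)).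
    apply: ler_sum => j _; rewrite mulrA ler_wpM2r ?lecR ?(ltW (y_gt0 j)) // -normrM.
    have := congr1 (fun w : 'rV__ => w 0 j) zA; rewrite !mxE => <-.
    apply: (le_trans (ler_norm_sum _ _ _)); apply: ler_sum => i _.
    by rewrite !mxE normrM (ger0_norm (x := (A i j)%:C%C)) // lecR.
  under eq_bigr do rewrite mulr_suml.
  rewrite exchange_big /=; apply: ler_sum => i _.
  under eq_bigr do rewrite -mulrA.
  rewrite -mulr_sumr mulrCA ler_wpM2l //.
  have := congr1 (fun w : 'cV__ => (w i 0)%:C%C) Ay; rewrite !mxE.
  by rewrite rmorph_sum rmorphM => <-; under [leRHS]eq_bigr do rewrite rmorphM.
apply/le_anti/andP; split; first by apply: ge_sup => //; exists rho.
by apply: ub_le_sup => //; exists rho.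
Qed.

End Perron.

Section PerronPair.
Context {R : realType} {n : nat} (n_gt0 : (0 < n)%N).
Implicit Types (A : 'M[R]_n).

(** The left and right eigenvectors come from A and its transpose separately;
    their eigenvalues agree because the product of the two is nonzero. *)
Lemma perron_pair A : irreducible_mx A ->
  exists (x : 'rV[R]_n) (y : 'cV[R]_n),
  [/\ forall i, 0 < x 0 i, x *m A = spectral_radius A *: x,
      forall i, 0 < y i 0, A *m y = spectral_radius A *: y &
      0 < spectral_radius A].
Proof.
move=> A_irr; have [rho [x [x_gt0 xA]]] := perron_exists n_gt0 A_irr.
have [rho' [y [y_gt0 yA]]] := perron_exists n_gt0 (irreducible_trmx A_irr).
have yT_gt0 i : 0 < y^T i 0 by rewrite mxE.
have xy_gt0 : 0 < (x *m y^T) 0 0.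
  by rewrite mxE sum_ord_gt0 // => i; rewrite mulr_gt0.
have rho_eq : rho' = rho.
  have Ay : A *m y^T = rho' *: y^T by rewrite -[A]trmxK -trmx_mul yA linearZ.
  have := congr1 (mulmx x) Ay; rewrite mulmxA xA -scalemxAl -scalemxAr.
  move=> /(congr1 (fun M : 'M[R]_1 => M 0 0)); rewrite !mxE => /mulIf -> //.
  by have := xy_gt0; rewrite mxE; exact: lt0r_neq0.
have Ay : A *m y^T = rho *: y^T.
  by rewrite -[A]trmxK -trmx_mul yA rho_eq linearZ.
have [A_ge0 _] := A_irr.
exists x, y^T; rewrite (spectral_radius_eq n_gt0 A_ge0 x_gt0 xA yT_gt0 Ay).
split=> //; suff [] : 0 < rho /\ forall i, 0 < x 0 i by [].
apply: (ge0_eigenvector_gt0 A_irr xA) => [i|]; first exact: ltW.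
apply/rV0Pn; exists (Ordinal n_gt0); exact: lt0r_neq0.
Qed.

Lemma spectral_radius_trmx A : irreducible_mx A ->
  spectral_radius A^T = spectral_radius A.
Proof.
move=> A_irr; have [x [y [x_gt0 xA y_gt0 Ay _]]] := perron_pair A_irr.
have [AT_ge0 _] := irreducible_trmx A_irr.
apply: (spectral_radius_eq (x := y^T) (y := x^T) n_gt0 AT_ge0) => [i||i|].
- by rewrite mxE.
- by rewrite -trmx_mul Ay linearZ.
- by rewrite mxE.
- by rewrite -trmx_mul xA linearZ.
Qed.

End PerronPair.

(** * Resolvents *)
Section PushThrough.
Context {F : fieldType} {s n : nat}.

(** The commutation (z + B C) B = B (z + C B), together with the Woodbury
    inverse z^-1 (1 - B (z + C B)^-1 C) of z + B C. *)
Lemma push_through (B : 'M[F]_(s, n)) (C : 'M[F]_(n, s)) (z : F) : z != 0 ->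
  z%:M + C *m B \in unitmx ->
  z%:M + B *m C \in unitmx /\
  invmx (z%:M + B *m C) *m B = B *m invmx (z%:M + C *m B).
Proof.
move=> z_neq0; set G := z%:M + C *m B => G_unit.
have MB : (z%:M + B *m C) *m B = B *m G.
  by rewrite mulmxDl mulmxDr -mulmxA mul_scalar_mx mul_mx_scalar.
have M_unit : z%:M + B *m C \in unitmx.
  suff /mulmx1_unit[] : (z%:M + B *m C) *m
      (z^-1 *: (1%:M - B *m invmx G *m C)) = 1%:M by [].
  rewrite -scalemxAr mulmxBr mulmx1 !mulmxA MB mulmxK // addrK.
  by rewrite scale_scalar_mx mulVf.
by split=> //; rewrite -[LHS](mulmxK G_unit) -[_ *m B *m G]mulmxA -MB mulKmx.
Qed.

End PushThrough.

Section Resolvent.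
Context {R : realType} {n : nat}.
Implicit Types (K : 'M[R]_n) (z : R).

(** Exhibits z + K as the value at z of a matrix of polynomials, so that its
    determinant and its adjugate are polynomial in z. *)
Lemma char_poly_mx_horner K z :
  map_mx (horner_eval z) (char_poly_mx (- K)) = z%:M + K.
Proof.
apply/matrixP => i j; rewrite !mxE /horner_eval !hornerE.
by rewrite hornerMn hornerX opprK.
Qed.

Lemma near_shift_unitmx K z : z%:M + K \in unitmx ->
  \forall w \near z, w%:M + K \in unitmx.
Proof.
have unitE w : (w%:M + K \in unitmx) = ((char_poly (- K)).[w] != 0).
  by rewrite unitmxE unitfE -char_poly_mx_horner det_map_mx.
rewrite unitE => z_neq0; near=> w; rewrite unitE; near: w.
exact: cvgr_neq0 (@continuous_horner _ _ z) z_neq0.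
Unshelve. all: by end_near. Qed.

(** Near z the inverse is the adjugate over a nonvanishing determinant.  The
    constant outer factors cover row sums, column sums and pairings at once. *)
Lemma resolvent_continuous m p (L : 'M[R]_(m, n)) K (c : 'M[R]_(n, p)) z i j :
  z%:M + K \in unitmx ->
  (L *m invmx (w%:M + K) *m c) i j @[w --> z] -->
  (L *m invmx (z%:M + K) *m c) i j.
Proof.
move=> G_unit.
have inv_cvg k l :
      invmx (w%:M + K) k l @[w --> z] --> invmx (z%:M + K) k l.
  pose g w := ((char_poly (- K)).[w])^-1 * (\adj (char_poly_mx (- K)) k l).[w].
  have gE w : w%:M + K \in unitmx -> invmx (w%:M + K) k l = g w.
    rewrite /invmx => ->; rewrite -char_poly_mx_horner det_map_mx.
    by rewrite -map_mx_adj mxE [X in _ * X]mxE.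
  rewrite (gE z) //; apply: (cvg_trans (near_eq_cvg (f := g) _)).
    by near=> w; rewrite gE //; near: w; exact: near_shift_unitmx.
  apply: cvgM; last exact: continuous_horner.
  apply: cvgV; last exact: continuous_horner.
  have := G_unit.
  by rewrite unitmxE unitfE -char_poly_mx_horner det_map_mx.
rewrite mxE; under eq_cvg do rewrite mxE.
apply: cvg_big => [|k _]; first exact: add_continuous.
apply: cvgM; last exact: cvg_cst.
rewrite mxE; under eq_cvg do rewrite mxE.
apply: cvg_big => [|l _]; first exact: add_continuous.
by apply: cvgM; [exact: cvg_cst | exact: inv_cvg].
Unshelve. all: by end_near. Qed.

End Resolvent.

(** * The matrix of forbidden pairs at the Perron root *)

Section ForbiddenMatrix.
Context {R : realType} {n : nat} (n_gt0 : (0 < n)%N).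
Implicit Types (A : 'M[R]_n).

Definition forbidden_mx A : 'M[R]_n := ones - A.

(** A positive right eigenvector of A, normalised to have sum 1, in the form in
    which the correlation matrix produces it. *)
Definition perron_vec A : 'cV[R]_n :=
  invmx ((spectral_radius A)%:M + forbidden_mx A) *m ones.

(** The all-ones matrix as a product of a column by a row: the shift differs
    from rho - A by a rank-one matrix. *)
Lemma forbidden_mxE A : forbidden_mx A = ones *m (ones : 'rV_n) - A.
Proof.
congr (_ - _); apply/matrixP => i j.
by rewrite !mxE big_ord1 !mxE mulr1.
Qed.

(** Pairing w (rho - A + J) = 0 with the right Perron eigenvector kills
    rho - A and leaves (w 1) times a positive number; so w is orthogonal to 1
    and is a left eigenvector, which by simplicity and positivity forces
    w = 0. *)
Lemma perron_shift_unitmx A : irreducible_mx A ->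
  (spectral_radius A)%:M + forbidden_mx A \in unitmx.
Proof.
move=> A_irr.
have [x [y [x_gt0 xA y_gt0 Ay rho_gt0]]] := perron_pair n_gt0 A_irr.
set rho := spectral_radius A in xA Ay rho_gt0 *.
have sum_gt0 (k : 'I_n -> R) := @sum_ord_gt0 R n k n_gt0.
rewrite -row_free_unit; apply/inj_row_free => w.
rewrite forbidden_mxE mulmxDr mulmxBr mulmxA mul_mx_scalar => wG0.
have w1 : w *m ones = 0 :> 'M[R]_1.
  have := congr1 (mulmx^~ y) wG0; rewrite mul0mx mulmxDl mulmxBl.
  rewrite -(mulmxA w A) Ay -scalemxAr -scalemxAl addrC subrK -!mulmxA mulmxA.
  move=> /(congr1 (fun M : 'M[R]_1 => M 0 0)) /eqP.
  rewrite [X in X == _]mxE big_ord1 [X in _ == X]mxE mulf_eq0 => /orP[/eqP w1|].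
    by apply/matrixP => i j; rewrite !ord1 w1 mxE.
  rewrite mxE; under eq_bigr do rewrite mxE mul1r.
  by rewrite (gt_eqF (sum_gt0 _ y_gt0)).
have wA : w *m A = rho *: w.
  by move: wG0; rewrite w1 mul0mx sub0r => /eqP; rewrite subr_eq0 => /eqP.
have [m wE] := perron_simple A_irr xA x_gt0 wA.
move: w1; rewrite wE -scalemxAl => /(congr1 (fun M : 'M[R]_1 => M 0 0)) /eqP.
rewrite !mxE mulf_eq0; under eq_bigr do rewrite mxE mulr1.
by rewrite (gt_eqF (sum_gt0 _ x_gt0)) orbF => /eqP ->; rewrite scale0r.
Qed.

(** Pairing (rho - A + J) w = 1 with the left Perron eigenvector x kills
    rho - A and leaves (x 1) (1^T w) = x 1, so 1^T w = 1; the equation then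
    reduces to (rho - A) w = 0, and simplicity makes w positive. *)
Lemma perron_vecP A : irreducible_mx A ->
  [/\ A *m perron_vec A = spectral_radius A *: perron_vec A,
      forall i, 0 < perron_vec A i 0 &
      (ones : 'rV_n) *m perron_vec A = 1%:M].
Proof.
move=> A_irr; have G_unit := perron_shift_unitmx A_irr.
have [x [y [x_gt0 xA y_gt0 Ay rho_gt0]]] := perron_pair n_gt0 A_irr.
set rho := spectral_radius A in xA Ay rho_gt0 *; set w := perron_vec A.
have sum_gt0 (k : 'I_n -> R) := @sum_ord_gt0 R n k n_gt0.
have Gw : (rho%:M + forbidden_mx A) *m w = ones by rewrite mulKVmx.
clearbody w.
have Gw' : rho *: w + (ones *m ((ones : 'rV_n) *m w) - A *m w) = ones.
  by rewrite -[RHS]Gw forbidden_mxE mulmxDl mulmxBl mulmxA mul_scalar_mx.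
have w1 : (ones : 'rV_n) *m w = 1%:M.
  have := congr1 (mulmx x) Gw'; rewrite mulmxDr mulmxBr !mulmxA xA.
  rewrite -scalemxAr -scalemxAl addrC subrK -!mulmxA mulmxA.
  move=> /(congr1 (fun M : 'M[R]_1 => M 0 0)).
  rewrite mxE big_ord1 -[RHS]mulr1 => /mulfI w1.
  apply/matrixP => i j; rewrite !ord1 w1 ?mxE //.
  by under eq_bigr do rewrite mxE mulr1; rewrite gt_eqF ?sum_gt0.
have Aw : A *m w = rho *: w.
  by move: Gw'; rewrite w1 mulmx1 addrCA -[RHS]addr0 => /addrI /eqP;
     rewrite subr_eq0 => /eqP.
split=> //.
have yA : y^T *m A^T = rho *: y^T by rewrite -trmx_mul Ay linearZ.
have wA : w^T *m A^T = rho *: w^T by rewrite -trmx_mul Aw linearZ.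
have yT_gt0 i : 0 < y^T 0 i by rewrite mxE.
have [m wE] := perron_simple (irreducible_trmx A_irr) yA yT_gt0 wA.
have wyE i : w i 0 = m * y i 0.
  by have := congr1 (fun v : 'rV[R]_n => v 0 i) wE; rewrite !mxE.
have m_gt0 : 0 < m.
  rewrite -(pmulr_lgt0 _ (sum_gt0 _ y_gt0)) mulr_sumr.
  under eq_bigr do rewrite -wyE.
  have -> : \sum_i w i 0 = ((ones : 'rV_n) *m w) 0 0.
    by rewrite mxE; apply: eq_bigr => i _; rewrite mxE mul1r.
  by rewrite w1 mxE ltr01.
by move=> i; rewrite wyE mulr_gt0.
Qed.

Lemma forbidden_mx_trmx A : (forbidden_mx A)^T = forbidden_mx A^T.
Proof. by rewrite /forbidden_mx linearB /= trmx_const. Qed.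

End ForbiddenMatrix.

(** * Correlation matrices of two-letter words *)
Section Words.
Context {R : realType} {n s : nat} (A : 'M[R]_n) (a : s.-tuple (seq 'I_n)).
Context (A01 : zero_one_mx A) (a_uniq : uniq a).
Context (a_F : a =i forbidden_words A).

Definition first_mx : 'M[R]_(s, n) :=
  \matrix_(i, x) (prefix [:: x] (tnth a i))%:R.

Definition last_mx : 'M[R]_(s, n) :=
  \matrix_(i, x) (suffix [:: x] (tnth a i))%:R.

Lemma prefix_pair (x p q : 'I_n) : prefix [:: x] [:: p; q] = (x == p).
Proof. by rewrite /= andbT. Qed.

Lemma suffix_pair (x p q : 'I_n) : suffix [:: x] [:: p; q] = (x == q).
Proof. by rewrite /suffix /rev /= andbT. Qed.

Lemma forbidden_pair i : exists p q, tnth a i = [:: p; q].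
Proof.
have := mem_tnth i a; rewrite a_F => /mapP[[p q] _ ->].
by exists p, q.
Qed.

Lemma sum_eq_nat (T : finType) (F : T -> R) p :
  \sum_x (x == p)%:R * F x = F p.
Proof.
rewrite (bigD1 p) //= eqxx mul1r big1 ?addr0 // => x /negPf ->.
by rewrite mul0r.
Qed.

(** Words rt and pq of length two overlap in full when they are equal, which
    gives the diagonal term z, and in one letter when t = p. *)
Lemma corr_mx_horner z :
  map_mx (fun p : {poly R} => p.[z]) (corr_mx a) = z%:M + first_mx *m last_mx^T.
Proof.
apply/matrixP => i j; rewrite !mxE /corr_poly.
under [in RHS]eq_bigr do rewrite !mxE.
have [p [q ai]] := forbidden_pair i; have [r [t aj]] := forbidden_pair j.
have eq_ij : (i == j) = (r == p) && (t == q).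
  rewrite -(inj_eq (tuple_uniqP _ a_uniq)) ai aj !eqseq_cons eqxx andbT.
  by rewrite !(eq_sym r) !(eq_sym t).
rewrite ai aj; under [in RHS]eq_bigr do rewrite prefix_pair suffix_pair.
rewrite (sum_eq_nat (fun x => (x == t)%:R)) big_ord_recl big_ord1 /= eq_ij.
have -> : corr_bit [:: r; t] [:: p; q] 0 = (r == p) && (t == q).
  apply/forallP/andP => [H|[/eqP -> /eqP ->] [[|[|k]]] //=].
  by have := H ord0; have := H ord_max.
have -> : corr_bit [:: r; t] [:: p; q] 1 = (p == t).
  apply/forallP/eqP => [H|-> [[|k]] //=].
  by have /eqP[] := H ord0.
by rewrite !hornerE mulr_natl.
Qed.

Lemma sum_words (F : seq 'I_n -> R) :
  \sum_i F (tnth a i) = \sum_p (A p.1 p.2 == 0)%:R * F [:: p.1; p.2].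
Proof.
rewrite -(big_tuple _ _ a xpredT) /= (perm_big (forbidden_words A)) /=.
  rewrite big_map big_filter big_enum_cond /= big_mkcond /=.
  by apply: eq_bigr => p _; case: eqP => _; rewrite ?mul1r ?mul0r.
apply: uniq_perm => //.
rewrite map_inj_uniq; last by move=> [p q] [r t] [-> ->].
exact/filter_uniq/enum_uniq.
Qed.

(** The (x, y) entry counts the forbidden words xy: it is 1 or 0 according to
    whether A x y vanishes, that is 1 - A x y for a 0/1 matrix. *)
Lemma tr_first_last_mx : first_mx^T *m last_mx = forbidden_mx A.
Proof.
apply/matrixP => x y; rewrite !mxE; under eq_bigr do rewrite !mxE.
rewrite (sum_words (fun w => (prefix [:: x] w)%:R * (suffix [:: y] w)%:R)).
rewrite (bigD1 (x, y)) //= !suffix_pair !eqxx !mulr1 big1 ?addr0.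
  by have [->|->] := A01 x y; rewrite ?eqxx ?oner_eq0 ?subr0 ?subrr.
move=> [p q]; rewrite xpair_eqE negb_and => /orP[] /negPf npq /=;
  by rewrite ?suffix_pair [_ == p]eq_sym ?[_ == q]eq_sym npq ?(mulr0, mul0r).
Qed.

Lemma first_mx_ones : first_mx *m (ones : 'cV_n) = ones.
Proof.
apply/matrixP => i j; rewrite !mxE; have [p [q ai]] := forbidden_pair i.
under eq_bigr do rewrite !mxE ai prefix_pair.
exact: (sum_eq_nat (fun=> 1)).
Qed.

Lemma last_mx_ones : last_mx *m (ones : 'cV_n) = ones.
Proof.
apply/matrixP => i j; rewrite !mxE; have [p [q ai]] := forbidden_pair i.
under eq_bigr do rewrite !mxE ai suffix_pair.
exact: (sum_eq_nat (fun=> 1)).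
Qed.

End Words.

Section Reduction.
Context {R : realType} {n s : nat} (A : 'M[R]_n) (a : s.-tuple (seq 'I_n)).
Context (A01 : zero_one_mx A) (a_uniq : uniq a).
Context (a_F : a =i forbidden_words A).
Local Notation K := (forbidden_mx A).
Local Notation B := (first_mx a).
Local Notation E := (last_mx a).

Lemma tr_last_first_mx : E^T *m B = K^T.
Proof. by rewrite -(tr_first_last_mx A01 a_uniq a_F) trmx_mul trmxK. Qed.

(** As B 1 = 1, the row sums M^-1 1 equal M^-1 B 1 = B (z + K^T)^-1 1. *)
Lemma corr_row_sumE i z : z != 0 -> z%:M + K^T \in unitmx ->
  corr_row_sum a i z = (B *m invmx (z%:M + K^T) *m (ones : 'cV_n)) i 0.
Proof.
move=> z_neq0; rewrite -tr_last_first_mx => G_unit.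
have [_ <-] := push_through z_neq0 G_unit.
rewrite -mulmxA (first_mx_ones a_F) mxE /corr_row_sum; apply: eq_bigr => j _.
by rewrite /inv_corr_mx (corr_mx_horner a_uniq a_F) [ones _ _]mxE mulr1.
Qed.

(** The same computation for the transpose of M, which exchanges B and E. *)
Lemma corr_col_sumE j z : z != 0 -> z%:M + K \in unitmx ->
  corr_col_sum a j z = (E *m invmx (z%:M + K) *m (ones : 'cV_n)) j 0.
Proof.
move=> z_neq0; rewrite -(tr_first_last_mx A01 a_uniq a_F) => G_unit.
have [_ <-] := push_through z_neq0 G_unit.
rewrite -mulmxA (last_mx_ones a_F) mxE /corr_col_sum; apply: eq_bigr => i _.
rewrite /inv_corr_mx (corr_mx_horner a_uniq a_F) [ones _ _]mxE mulr1.
have -> : z%:M + E *m B^T = (z%:M + B *m E^T)^T.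
  by rewrite linearD /= tr_scalar_mx trmx_mul trmxK.
by rewrite -trmx_inv mxE.
Qed.

(** With y = (z + K^T)^-1 1, the sum of the row sums is 1^T B y = 1^T E^T B y
    = 1^T K^T y, and K^T y = 1 - z y. *)
Lemma corr_sumE z : z != 0 -> z%:M + K^T \in unitmx ->
  corr_sum a z = n%:R
    - z * ((ones : 'rV_n) *m invmx (z%:M + K^T) *m (ones : 'cV_n)) 0 0.
Proof.
move=> z_neq0 G_unit; set y := invmx (z%:M + K^T) *m (ones : 'cV_n).
have -> : corr_sum a z = ((ones : 'rV_s) *m (B *m y)) 0 0.
  rewrite mxE; apply: eq_bigr => i _; rewrite -/(corr_row_sum a i z).
  by rewrite corr_row_sumE // mulmxA [ones _ _]mxE mul1r.
have -> : (ones : 'rV[R]_s) = (ones : 'rV_n) *m E^T.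
  by rewrite -[LHS]trmxK trmx_const -(last_mx_ones a_F) trmx_mul trmx_const.
rewrite -[_ *m E^T *m _]mulmxA (mulmxA E^T) tr_last_first_mx.
have -> : K^T *m y = ones - z *: y.
  apply/eqP; rewrite eq_sym subr_eq addrC -mul_scalar_mx -mulmxDl.
  by rewrite mulKVmx.
rewrite mulmxBr -scalemxAr -mulmxA mxE [X in _ + X]mxE [X in _ - X]mxE.
congr (_ - _).
rewrite mxE; under eq_bigr do rewrite !mxE mulr1.
by rewrite sumr_const card_ord.
Qed.

End Reduction.

(** * Regularity at the Perron root *)
Section RegVal.
Context {R : realType}.
Implicit Types (f g : R -> R) (z : R).

Lemma near_eq_continuous_cvg f g z :
  (\forall w \near z, f w = g w) -> g w @[w --> z] --> g z ->
  f w @[w --> z] --> f z.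
Proof.
move=> fg g_cvg; rewrite (nbhs_singleton fg); apply: cvg_trans g_cvg.
by apply: near_eq_cvg; near do apply/esym.
Unshelve. all: by end_near. Qed.

Lemma reg_val_continuous f z : f w @[w --> z] --> f z ->
  f w @[w --> z^'] --> f z /\ reg_val f z = f z.
Proof.
move=> f_cvg; suff fz : f w @[w --> z^'] --> f z.
  by split=> //; exact: cvg_lim fz.
exact: cvg_within_filter.
Qed.

End RegVal.

Section PerronRoot.
Context {R : realType} {n s : nat}.
Context (A : 'M[R]_n) (a : s.-tuple (seq 'I_n)).
Context (n_gt0 : (0 < n)%N) (A01 : zero_one_mx A) (A_irr : irreducible_mx A).
Context (a_uniq : uniq a) (a_F : a =i forbidden_words A).
Local Notation theta := (spectral_radius A).
Local Notation K := (forbidden_mx A).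
Local Notation B := (first_mx a).
Local Notation E := (last_mx a).
Local Notation left_vec := (perron_vec A^T).
Local Notation right_vec := (perron_vec A).

Lemma spectral_radius_gt0 : 0 < theta.
Proof. by have [x [y []]] := perron_pair n_gt0 A_irr. Qed.

Lemma near_theta_neq0 : \forall z \near theta, z != 0.
Proof. exact: cvgr_neq0 cvg_id (lt0r_neq0 spectral_radius_gt0). Qed.

Lemma shift_tr_unitmx : theta%:M + K^T \in unitmx.
Proof.
rewrite forbidden_mx_trmx -(spectral_radius_trmx n_gt0 A_irr).
exact/perron_shift_unitmx/irreducible_trmx.
Qed.

Lemma left_vecE : left_vec = invmx (theta%:M + K^T) *m ones.
Proof.
by rewrite /perron_vec (spectral_radius_trmx n_gt0 A_irr) forbidden_mx_trmx.
Qed.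

(** M(theta) is itself invertible, so the row sums are continuous at theta and
    their limit is their value. *)
Lemma corr_row_sum_theta i :
  corr_row_sum a i z @[z --> theta] --> corr_row_sum a i theta /\
  corr_row_sum a i theta = (B *m left_vec) i 0.
Proof.
split; last first.
  rewrite (corr_row_sumE A01 a_uniq a_F) ?shift_tr_unitmx //.
    by rewrite -mulmxA -left_vecE.
  exact: lt0r_neq0 spectral_radius_gt0.
apply: (near_eq_continuous_cvg _ (resolvent_continuous
  (L := B) (c := ones : 'cV_n) (i := i) (j := 0) shift_tr_unitmx)).
near=> z; rewrite (corr_row_sumE A01 a_uniq a_F) //; near: z.
  exact: near_theta_neq0.
exact/near_shift_unitmx/shift_tr_unitmx.
Unshelve. all: by end_near. Qed.

Lemma corr_col_sum_theta j :
  corr_col_sum a j z @[z --> theta] --> corr_col_sum a j theta /\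
  corr_col_sum a j theta = (E *m right_vec) j 0.
Proof.
have G_unit := perron_shift_unitmx n_gt0 A_irr.
split; last first.
  rewrite (corr_col_sumE A01 a_uniq a_F) //; first by rewrite -mulmxA.
  exact: lt0r_neq0 spectral_radius_gt0.
apply: (near_eq_continuous_cvg _ (resolvent_continuous
  (L := E) (c := ones : 'cV_n) (i := j) (j := 0) G_unit)).
near=> z; rewrite (corr_col_sumE A01 a_uniq a_F) //; near: z.
  exact: near_theta_neq0.
exact: near_shift_unitmx.
Unshelve. all: by end_near. Qed.

(** The entrywise form of 1 - (J - C) w = C w, valid since 1^T w = 1. *)
Lemma forbidden_mx_perron (C : 'M[R]_n) x : irreducible_mx C ->
  1 - (forbidden_mx C *m perron_vec C) x 0 =
  spectral_radius C * perron_vec C x 0.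
Proof.
move=> C_irr; have [_ _ w1] := perron_vecP n_gt0 C_irr.
have Cw : C *m perron_vec C = spectral_radius C *: perron_vec C.
  by have [] := perron_vecP n_gt0 C_irr.
rewrite forbidden_mxE mulmxBl -mulmxA w1 mulmx1 Cw !mxE.
by rewrite opprB addrCA subrr addr0.
Qed.

(** The function q is z |-> w^T y(z), with w the right Perron vector at theta
    and y(z) = (z + K^T)^-1 1.  Since w^T (z + K^T) = 1^T + (z - theta) w^T,
    multiplying by y(z) gives 1 = 1^T y(z) + (z - theta) q(z), which is then
    substituted in [corr_sumE]. *)
Lemma corr_sum_theta :
  exists q : R -> R, [/\ q z @[z --> theta] --> q theta,
    q theta = (right_vec^T *m left_vec) 0 0 &
    \forall z \near theta, corr_sum a z = n%:R - z + z * (z - theta) * q z].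
Proof.
exists (fun z => (right_vec^T *m invmx (z%:M + K^T) *m (ones : 'cV_n)) 0 0).
split.
- exact: resolvent_continuous shift_tr_unitmx.
- by rewrite -mulmxA -left_vecE.
near=> z.
have z_neq0 : z != 0 by near: z; exact: near_theta_neq0.
have G_unit : z%:M + K^T \in unitmx.
  by near: z; exact/near_shift_unitmx/shift_tr_unitmx.
rewrite (corr_sumE A01 a_uniq a_F) //; set G := z%:M + K^T in G_unit *.
have wG : right_vec^T *m G = ones + (z - theta) *: right_vec^T.
  have wT : right_vec^T *m (theta%:M + K^T) = ones.
    rewrite -tr_scalar_mx -linearD -trmx_mul mulKVmx ?trmx_const //.
    exact: perron_shift_unitmx.
  rewrite -[in RHS]wT /G !mulmxDr !mul_mx_scalar scalerBl.
  by rewrite addrAC addrCA subrr addr0 addrC.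
have w1 : (right_vec^T *m (ones : 'cV_n)) 0 0 = 1.
  have [_ _ /(congr1 trmx)] := perron_vecP n_gt0 A_irr.
  by rewrite trmx_mul trmx_const tr_scalar_mx => ->; rewrite mxE.
have : (right_vec^T *m G *m invmx G *m (ones : 'cV_n)) 0 0 = 1 by rewrite mulmxK.
rewrite wG !mulmxDl -!scalemxAl mxE [X in _ + X]mxE => /eqP.
rewrite eq_sym -subr_eq => /eqP <-; ring.
Unshelve. all: by end_near. Qed.

Lemma corr_sum_continuous z : z != 0 -> z%:M + K^T \in unitmx ->
  corr_sum a w @[w --> z] --> corr_sum a z.
Proof.
move=> z_neq0 G_unit.
pose f w := n%:R - w *
  ((ones : 'rV_n) *m invmx (w%:M + K^T) *m (ones : 'cV_n)) 0 0.
apply: (@near_eq_continuous_cvg _ _ f); last first.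
  apply: cvgB; first exact: cvg_cst.
  by apply: cvgM; [exact: cvg_id | exact: resolvent_continuous].
near=> w; rewrite (corr_sumE A01 a_uniq a_F) //; near: w.
  exact: cvgr_neq0 cvg_id z_neq0.
exact: near_shift_unitmx.
Unshelve. all: by end_near. Qed.

(** Caratheodory's criterion: the difference between n - z + z (z - theta) q(z)
    and its value at theta is (z - theta) (z q(z) - 1), and z q(z) - 1 is
    continuous at theta. *)
Lemma derive_corr_sum :
  is_derive theta 1 (reg_val (corr_sum a))
    (theta * (right_vec^T *m left_vec) 0 0 - 1).
Proof.
have [q [q_cvg q_theta q_near]] := corr_sum_theta; rewrite -q_theta.
apply: (@near_eq_is_derive R R^o R^o
  (fun z => n%:R - z + z * (z - theta) * q z)); last first.
  apply/is_derive1_caratheodory; exists (fun z => z * q z - 1); split=> //.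
    by move=> z; ring.
  apply: cvgB; last exact: cvg_cst.
  by apply: cvgM; [exact: cvg_id | exact: q_cvg].
near=> z; transitivity (corr_sum a z).
  by apply/esym; near: z.
apply/esym; have [|_ //] := @reg_val_continuous _ (corr_sum a) z.
apply: corr_sum_continuous; near: z; first exact: near_theta_neq0.
exact/near_shift_unitmx/shift_tr_unitmx.
Unshelve. all: by end_near. Qed.

End PerronRoot.

(** * Perron eigenvectors from correlations *)

Lemma tr_mx11 (F : nmodType) (M : 'M[F]_1) : M^T = M.
Proof. by apply/matrixP => i j; rewrite mxE !ord1. Qed.

Theorem theorem3 (R : realType) (n : nat) (n_gt0 : (0 < n)%N)
    (A : 'M[R]_n) (A01 : zero_one_mx A) (A_irr : irreducible_mx A)
    (theta : R) (theta_def : theta = spectral_radius A)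
    (s : nat) (a : s.-tuple (seq 'I_n))
    (a_uniq : uniq a) (a_F : a =i forbidden_words A)
    (u v : 'cV[R]_n)
    (u_def : forall x, u x 0 =
      1 - \sum_(i < s | suffix [:: x] (tnth a i))
            reg_val (corr_row_sum a i) theta)
    (v_def : forall x, v x 0 =
      1 - \sum_(i < s | prefix [:: x] (tnth a i))
            reg_val (corr_col_sum a i) theta) :
  (* the limits defining u and v exist *)
  (forall i, cvg (corr_row_sum a i z @[z --> theta^'])) /\
  (forall i, cvg (corr_col_sum a i z @[z --> theta^'])) /\
  (forall x, 0 < u x 0 * v x 0) /\
  right_perron_eigenvector A v /\
  left_perron_eigenvector A u /\
  (1 < theta ->
    derivable (reg_val (corr_sum a)) theta 1 /\
    (u^T *m v) 0 0 = theta * (1 + derive1 (reg_val (corr_sum a)) theta)).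
Proof.
have theta_gt0 : 0 < theta by rewrite theta_def; exact: spectral_radius_gt0.
have AT_irr := irreducible_trmx A_irr.
have rho_tr := spectral_radius_trmx n_gt0 A_irr.
have row_cvg i :
    corr_row_sum a i z @[z --> theta^'] --> corr_row_sum a i theta /\
    reg_val (corr_row_sum a i) theta = (first_mx a *m perron_vec A^T) i 0.
  have [r_cvg r_val] := corr_row_sum_theta n_gt0 A01 A_irr a_uniq a_F i.
  rewrite theta_def; have [? ->] := reg_val_continuous r_cvg.
  by split=> //; rewrite r_val.
have col_cvg j :
    corr_col_sum a j z @[z --> theta^'] --> corr_col_sum a j theta /\
    reg_val (corr_col_sum a j) theta = (last_mx a *m perron_vec A) j 0.
  have [c_cvg c_val] := corr_col_sum_theta n_gt0 A01 A_irr a_uniq a_F j.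
  rewrite theta_def; have [? ->] := reg_val_continuous c_cvg.
  by split=> //; rewrite c_val.
have uE : u = theta *: perron_vec A^T.
  apply/matrixP => x j; rewrite !ord1 [RHS]mxE u_def.
  have := forbidden_mx_perron n_gt0 x AT_irr; rewrite rho_tr -theta_def => <-.
  congr (1 - _); rewrite -forbidden_mx_trmx.
  rewrite -(tr_last_first_mx A01 a_uniq a_F) -mulmxA mxE big_mkcond /=.
  apply: eq_bigr => i _; have [_ ->] := row_cvg i; rewrite !mxE.
  by case: ifP; rewrite ?mul1r ?mul0r.
have vE : v = theta *: perron_vec A.
  apply/matrixP => x j; rewrite !ord1 [RHS]mxE v_def.
  have := forbidden_mx_perron n_gt0 x A_irr; rewrite -theta_def => <-.
  congr (1 - _); rewrite -(tr_first_last_mx A01 a_uniq a_F).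
  rewrite -mulmxA mxE big_mkcond /=.
  apply: eq_bigr => i _; have [_ ->] := col_cvg i; rewrite !mxE.
  by case: ifP; rewrite ?mul1r ?mul0r.
have [ATl l_gt0 _] := perron_vecP n_gt0 AT_irr.
have [Ar r_gt0 _] := perron_vecP n_gt0 A_irr.
have u_gt0 x : 0 < u x 0 by rewrite uE mxE; exact: mulr_gt0 (l_gt0 x).
have v_gt0 x : 0 < v x 0 by rewrite vE mxE; exact: mulr_gt0 (r_gt0 x).
have gt0_neq0 (w : 'cV[R]_n) : (forall x, 0 < w x 0) -> w != 0.
  move=> w_gt0; apply/cV0Pn; exists (Ordinal n_gt0); exact: lt0r_neq0.
split.
  by move=> i; apply/cvg_ex; exists (corr_row_sum a i theta); case: (row_cvg i).
split.
  by move=> i; apply/cvg_ex; exists (corr_col_sum a i theta); case: (col_cvg i).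
split; first by move=> x; exact: mulr_gt0.
split.
  split; [exact: gt0_neq0| |exact: v_gt0].
  by rewrite vE -scalemxAr Ar theta_def.
split.
  split; [exact: gt0_neq0| |exact: u_gt0].
  rewrite -[A in LHS]trmxK -trmx_mul uE -scalemxAr ATl rho_tr -theta_def.
  by rewrite linearZ.
move=> _; have := derive_corr_sum n_gt0 A01 A_irr a_uniq a_F.
rewrite -theta_def => -[r_der r_val]; split; first exact: r_der.
rewrite derive1E r_val uE vE -scalemxAr [(_ *: _)^T]linearZ /= -scalemxAl.
rewrite -[_^T *m perron_vec A]tr_mx11 trmx_mul trmxK 2!mxE.
ring.
Qed.
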